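(* A non-abelian finite group $G$ is simple if and only if every map $G\to G$ is a word map with constants, i.e. for every map $f\colon G\to G$ there is $w\in\mathbf{F}_1\ast G$ with $w(g)=f(g)$ for all $g\in G$. Moreover, there is an absolute constant $K>0$ such that for every non-abelian finite simple group $G$ every map $G\to G$ is induced by a word $w\in\mathbf{F}_1\ast G$ of length $\ell(w)\le K\,|G|^3\operatorname{cn}(G)$.
   Context: $\mathbf{F}_1=\langle x\rangle$ is the free group on one generator $x$ and $\ast$ is the free product. An element $w\in\mathbf{F}_1\ast G$ (a word with constants in $G$) induces the word map with constants $w\colon G\to G$, where $w(g)$ is the image of $w$ under the unique homomorphism $\mathbf{F}_1\ast G\to G$ that is the identity on $G$ and maps $x\mapsto g$. Every $w\in\mathbf{F}_1\ast G$ can be written uniquely as $w=c_0x^{\varepsilon(1)}c_1\cdots c_{l-1}x^{\varepsilon(l)}c_l$ with $l\ge 0$, $\varepsilon(j)=\pm1$, $c_j\in G$, where $\varepsilon(j)=-\varepsilon(j+1)$ implies $c_j\ne 1_G$ ($1\le j\le l-1$); the length of $w$ is $\ell(w)=l$. The covering number $\operatorname{cn}(G)$ of a non-abelian finite simple group $G$ is the minimal $m$ such that $C^{\ast m}=G$ for all non-trivial conjugacy classes $C\neq\{1_G\}$ of $G$, where $C^{\ast m}=\{c_1\cdots c_m : c_1,\dots,c_m\in C\}$. *)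

(* Defs.v *)
From HB Require Import structures.
From mathcomp Require Import all_boot all_fingroup all_solvable.

Set Implicit Arguments.
Unset Strict Implicit.
Unset Printing Implicit Defensive.

Local Open Scope group_scope.

(* The free product <x> * G of the infinite cyclic group <x> with a group G.
   The pair (c_0, [:: (e_1, c_1); ...; (e_l, c_l)]) encodes
     c_0 x^{e_1} c_1 ... x^{e_l} c_l,
   where the boolean e_j is true for x and false for x^-1. *)

Definition raw_word (G : groupType) : Type := (G * seq (bool * G))%type.

Definition nocancel (G : groupType) : rel (bool * G) :=
  fun p q => (p.1 == ~~ q.1) ==> (p.2 != 1).

Definition reduced (G : groupType) : pred (raw_word G) :=
  fun w => sorted (@nocancel G) w.2.

Record free_prod (G : groupType) : Type :=
  FreeProd { fp_word : raw_word G ; fp_reduced : reduced fp_word }.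

HB.instance Definition _ (G : groupType) := [isSub of free_prod G for @fp_word G].
HB.instance Definition _ (G : groupType) := [Choice of free_prod G by <:].

Definition fp_length (G : groupType) (w : free_prod G) : nat := size (fp_word w).2.

Section GroupLaw.

Variable G : groupType.
Implicit Types (c : G) (e : bool) (s : seq (bool * G)) (u v w : raw_word G).

(* Left multiplication by c, resp. by x^e, on reduced words. *)
Definition lmul_cst c w : raw_word G := (c * w.1, w.2).

Definition lmul_var e w : raw_word G :=
  if w.2 is (e', c') :: s' then
    if (e == ~~ e') && (w.1 == 1) then (c', s') else (1, (e, w.1) :: w.2)
  else (1, [:: (e, w.1)]).

Definition lmul_tail s w : raw_word G :=
  foldr (fun p v => lmul_var p.1 (lmul_cst p.2 v)) w s.

Definition raw_mul u v : raw_word G := lmul_cst u.1 (lmul_tail u.2 v).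

Definition raw_one : raw_word G := (1, [::]).

Definition inv_tail s w : raw_word G :=
  foldl (fun v p => lmul_cst p.2^-1 (lmul_var (~~ p.1) v)) w s.

Definition raw_inv w : raw_word G := inv_tail w.2 (w.1^-1, [::]).

Lemma lmul_cst1 w : lmul_cst 1 w = w.
Proof. by case: w => c s; rewrite /lmul_cst mul1g. Qed.

Lemma lmul_cstM c c' w : lmul_cst (c * c') w = lmul_cst c (lmul_cst c' w).
Proof. by rewrite /lmul_cst mulgA. Qed.

Lemma reduced_cst c w : reduced w -> reduced (lmul_cst c w).
Proof. by []. Qed.

Lemma reduced_var e w : reduced w -> reduced (lmul_var e w).
Proof.
case: w => c [|[e' c'] s] //; rewrite /reduced /lmul_var /=.
case: ifP => [_ /path_sorted //|/negbT cancelF ws] /=; rewrite ws andbT.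
by rewrite /nocancel /=; move: cancelF; rewrite negb_and implybE.
Qed.

Lemma reduced_tail s w : reduced w -> reduced (lmul_tail s w).
Proof. by move=> rw; elim: s => //= p s IHs; apply/reduced_var/reduced_cst. Qed.

Lemma reduced_mul u v : reduced v -> reduced (raw_mul u v).
Proof. by move=> rv; apply/reduced_cst/reduced_tail. Qed.

Lemma reduced_inv_tail s w : reduced w -> reduced (inv_tail s w).
Proof. by elim: s w => //= p s IHs w rw; apply/IHs/reduced_cst/reduced_var. Qed.

Lemma reduced_inv w : reduced (raw_inv w).
Proof. exact: reduced_inv_tail. Qed.

Lemma lmul_varK e w : reduced w -> lmul_var (~~ e) (lmul_var e w) = w.
Proof.
case: w => c [|[e' c'] s]; rewrite /reduced /lmul_var /=; first by rewrite !eqxx.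
case: ifP => [/andP[/eqP-> /eqP->] | _ _] /=; last by rewrite !eqxx.
rewrite negbK; case: s => [|[e2 c2] s] //=.
by rewrite /nocancel /= => /andP[/implyP h _]; case: ifP => // /andP[/h/negPf->].
Qed.

Lemma mul_cst c u v : raw_mul (lmul_cst c u) v = lmul_cst c (raw_mul u v).
Proof. by rewrite /raw_mul lmul_cstM. Qed.

Lemma mul_var e u v :
  reduced v -> raw_mul (lmul_var e u) v = lmul_var e (raw_mul u v).
Proof.
case: u => c [|[e' c'] s] rv; rewrite {1}/lmul_var /=.
  by rewrite /raw_mul /= lmul_cst1.
case: ifP => [/andP[/eqP-> /eqP->] | _]; last by rewrite /raw_mul /= lmul_cst1.
rewrite /raw_mul /= lmul_cst1 lmul_varK //.
exact/reduced_cst/reduced_tail.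
Qed.

Lemma mul_tail s u v :
  reduced v -> raw_mul (lmul_tail s u) v = lmul_tail s (raw_mul u v).
Proof. by move=> rv; elim: s => //= p s IHs; rewrite mul_var // mul_cst IHs. Qed.

Lemma raw_mulA u v w :
  reduced w -> raw_mul u (raw_mul v w) = raw_mul (raw_mul u v) w.
Proof.
by move=> rw; rewrite -[raw_mul u v]/(lmul_cst u.1 (lmul_tail u.2 v)) mul_cst mul_tail.
Qed.

Lemma lmul_tail1 s : sorted (@nocancel G) s -> lmul_tail s raw_one = (1, s).
Proof.
elim: s => //= -[e c] s IHs ps; rewrite IHs ?(path_sorted ps) //.
rewrite /lmul_cst /lmul_var /= mulg1.
case: s ps {IHs} => [|[e' c'] s] //= /andP[+ _]; rewrite /nocancel /=.
by move/implyP=> h; case: ifP => // /andP[/h/negPf->].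
Qed.

Lemma raw_mulw1 w : reduced w -> raw_mul w raw_one = w.
Proof.
by case: w => c s rw; rewrite /raw_mul lmul_tail1 // /lmul_cst mulg1.
Qed.

Lemma raw_mul1w w : raw_mul raw_one w = w.
Proof. exact: lmul_cst1. Qed.

Lemma mul_inv_tail s u v :
  reduced v -> raw_mul (inv_tail s u) v = inv_tail s (raw_mul u v).
Proof.
by move=> rv; elim: s u => //= p s IHs u; rewrite IHs mul_cst mul_var.
Qed.

Lemma inv_tailK s w : reduced w -> inv_tail s (lmul_tail s w) = w.
Proof.
elim: s w => //= p s IHs w rw; rewrite lmul_varK; last exact/reduced_cst/reduced_tail.
by rewrite -lmul_cstM mulVg lmul_cst1 IHs.
Qed.

Lemma raw_mulVw w : reduced w -> raw_mul (raw_inv w) w = raw_one.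
Proof.
move=> rw; rewrite /raw_inv mul_inv_tail //.
have -> : raw_mul (w.1^-1, [::]) w = (1, w.2) by rewrite -[LHS]/(_, _) mulVg.
by rewrite -(lmul_tail1 rw) inv_tailK.
Qed.

Definition fp_mul (u v : free_prod G) : free_prod G :=
  FreeProd (reduced_mul (fp_word u) (fp_reduced v)).
Definition fp_one : free_prod G := @FreeProd G raw_one isT.
Definition fp_inv (w : free_prod G) : free_prod G :=
  FreeProd (reduced_inv (fp_word w)).

Lemma fp_mulA : associative fp_mul.
Proof. by move=> u v w; apply/val_inj/raw_mulA/fp_reduced. Qed.

Lemma fp_mul1w : left_id fp_one fp_mul.
Proof. by move=> w; apply/val_inj/raw_mul1w. Qed.

Lemma fp_mulw1 : right_id fp_one fp_mul.
Proof. by move=> w; apply/val_inj/raw_mulw1/fp_reduced. Qed.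

Lemma fp_mulVw : left_inverse fp_one fp_inv fp_mul.
Proof. by move=> w; apply/val_inj/raw_mulVw/fp_reduced. Qed.

Lemma fp_mulwV : right_inverse fp_one fp_inv fp_mul.
Proof.
move=> w; rewrite -[LHS]fp_mul1w -{1}(fp_mulVw (fp_inv w)) -fp_mulA.
by rewrite [fp_mul (fp_inv w) _]fp_mulA fp_mulVw fp_mul1w fp_mulVw.
Qed.

End GroupLaw.

HB.instance Definition _ (G : groupType) :=
  isGroup.Build (free_prod G) (@fp_mulA G) (@fp_mul1w G) (@fp_mulw1 G)
    (@fp_mulVw G) (@fp_mulwV G).

Definition fp_cst (G : groupType) (c : G) : free_prod G :=
  @FreeProd G (c, [::]) isT.

Definition fp_var (G : groupType) : free_prod G :=
  @FreeProd G (1, [:: (true, 1)]) isT.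

Lemma fp_cstM (G : groupType) : {morph @fp_cst G : c d / c * d}.
Proof. by move=> c d; apply/val_inj. Qed.

HB.instance Definition _ (G : groupType) :=
  isUMagmaMorphism.Build G (free_prod G) (@fp_cst G) (erefl, @fp_cstM G).

Definition fp_lift (G H : groupType) (phi : G -> H) (h : H) (w : free_prod G) : H :=
  phi (fp_word w).1
    * foldr (fun p r => (if p.1 then h else h^-1) * (phi p.2 * r)) 1 (fp_word w).2.

(* The universal property of free_prod G: phi : G -> H and h extend uniquely to a
   morphism free_prod G -> H. *)
Section Universal.

Variables (G H : groupType) (phi : UMagmaMorphism.type G H) (h : H).

Let pw (e : bool) : H := if e then h else h^-1.
Let tl (s : seq (bool * G)) : H :=
  foldr (fun p r => pw p.1 * (phi p.2 * r)) 1 s.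
Let ev (w : raw_word G) : H := phi w.1 * tl w.2.

Let ev_cst c w : ev (lmul_cst c w) = phi c * ev w.
Proof. by rewrite /ev /= gmulfM mulgA. Qed.

Let ev_var e w : ev (lmul_var e w) = pw e * ev w.
Proof.
case: w => c [|[e' c'] s]; rewrite /ev /lmul_var /=; first by rewrite gmulf1 mul1g.
case: ifP => [/andP[/eqP-> /eqP->] | _] /=; last by rewrite gmulf1 mul1g.
by rewrite gmulf1 mul1g /pw; case: e' => /=; rewrite ?mulKg ?mulVKg.
Qed.

Let ev_tail s w : ev (lmul_tail s w) = tl s * ev w.
Proof.
elim: s => /= [|p s IHs]; first by rewrite mul1g.
by rewrite ev_var ev_cst IHs !mulgA.
Qed.

Lemma fp_lift1 : fp_lift phi h 1 = 1.
Proof. by rewrite /fp_lift /= gmulf1 mulg1. Qed.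

Lemma fp_liftM : {morph fp_lift phi h : u v / u * v}.
Proof. by move=> u v; rewrite -[LHS]/(ev _) ev_cst ev_tail mulgA. Qed.

HB.instance Definition _ :=
  isUMagmaMorphism.Build (free_prod G) H (fp_lift phi h) (fp_lift1, fp_liftM).

Lemma fp_lift_cst c : fp_lift phi h (fp_cst c) = phi c.
Proof. by rewrite /fp_lift /= mulg1. Qed.

Lemma fp_lift_var : fp_lift phi h (fp_var G) = h.
Proof. by rewrite /fp_lift /= !gmulf1 !mul1g mulg1. Qed.

Lemma fp_lift_unique (psi : UMagmaMorphism.type (free_prod G) H) :
  (forall c, psi (fp_cst c) = phi c) -> psi (fp_var G) = h ->
  psi =1 fp_lift phi h.
Proof.
move=> psi_cst psi_var [[c s] rw].
have psiV : psi (fp_var G)^-1 = h^-1.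
  by apply/(mulgI h); rewrite mulgV -{1}psi_var -gmulfM mulgV gmulf1.
pose x e : free_prod G := if e then fp_var G else (fp_var G)^-1.
have psi_x e : psi (x e) = pw e by case: e => /=.
have xE e w : fp_word (x e * w) = lmul_var e (fp_word w).
  have mulxw v : fp_word (fp_var G * v) = lmul_var true (fp_word v).
    by rewrite -[LHS]/(lmul_cst _ (lmul_var _ (lmul_cst _ _))) !lmul_cst1.
  case: e => //; rewrite /x; set v := (fp_var G)^-1 * w.
  have <- : fp_var G * v = w by apply: mulVKg.
  by rewrite mulxw; apply/esym/(@lmul_varK G true)/fp_reduced.
clearbody x; pose t := foldr (fun p w => x p.1 * (fp_cst p.2 * w)) (1 : free_prod G) s.
have tE : fp_word t = (1, s).
  rewrite -(lmul_tail1 rw) /t; elim: (s) => // p s' IHs.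
  by apply: etrans (xE _ _) _; rewrite [in RHS]/= -IHs.
have -> : FreeProd rw = fp_cst c * t.
  apply/val_inj; rewrite /= -[RHS]/(lmul_cst c (fp_word t)) tE.
  by rewrite /lmul_cst mulg1.
rewrite gmulfM psi_cst -[RHS]/(ev _) -[fp_word _]/(lmul_cst c (fp_word t)) ev_cst.
congr (_ * _); rewrite tE /ev /= gmulf1 mul1g /t; elim: (s) => /= [|p s' IHs].
  exact: gmulf1.
by rewrite !gmulfM psi_x psi_cst IHs.
Qed.

End Universal.

Definition word_map (G : groupType) (w : free_prod G) (g : G) : G :=
  fp_lift idfun g w.

(* C ^+ m is the pointwise product C * ... * C in {set gT}. *)
Definition class_power_cover (gT : finGroupType) (m : nat) : bool :=
  [forall C in classes [set: gT], (C != [1 gT]) ==> (C ^+ m == [set: gT])].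

Lemma class_power_cover_exists (gT : finGroupType) :
  ~~ abelian [set: gT] -> simple [set: gT] ->
  exists m, class_power_cover gT m.
Proof.
move=> nabG /simpleP[ntG simG].
have mulT (A : {set gT}) : A != set0 -> A * [set: gT] = [set: gT].
  case/set0Pn=> a Aa; apply/setP=> y; rewrite inE; apply/mulsgP.
  by exists a (a^-1 * y); rewrite ?inE ?mulVKg.
have coverC (C : {set gT}) : exists n, C \in classes [set: gT] -> C != [1 gT] ->
    forall m, n <= m -> C ^+ m = [set: gT].
  have [/imsetP[x _ ->{C}] | _] := boolP (C \in classes _); last by exists 0.
  set C := x ^: _; have [-> | ntC] := eqVneq C [1 gT]; first by exists 0.
  have Cx : x \in C by apply: class_refl.
  have nC : [set: gT] \subset 'N(C) by apply: class_norm.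
  have nCn n : [set: gT] \subset 'N(C ^+ n).
    elim: n => [|n IHn]; first by rewrite expg0 norms1.
    by rewrite expgS normsM.
  have memC n : x ^+ n \in C ^+ n.
    by elim: n => [|n IHn]; rewrite ?expg0 ?set11 // !expgS mem_mulg.
  pose A := C ^+ #|gT|.
  have A1 : 1 \in A by rewrite -(expg_cardG (in_setT x)) cardsT; apply: memC.
  have neqA1 : <<A>> != 1.
    apply: contra ntC => /eqP/trivgP; rewrite gen_subG => /subsetP sA1.
    have Cx1 y : y \in C -> y = x.
      case Do: #|gT| => [|o] in A A1 sA1 *; first by have := fintype0 x Do.
      move=> Cy; apply: (mulIg (x ^+ o)); rewrite -expgS -Do -cardsT.
      rewrite (expg_cardG (in_setT x)); apply/set1P/sA1.
      by rewrite /A expgS mem_mulg.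
    have Zx : x \in 'Z([set: gT]).
      apply/centerP; split=> [|y _]; first exact: in_setT.
      by apply/commgP/conjg_fixP/Cx1/memJ_class/in_setT.
    have [Z1|ZG] := simG _ (center_normal [set: gT]).
      by move: Zx; rewrite /C Z1 => /set1P->; rewrite class1G.
    by case/negP: nabG; apply/center_idP.
  have genA : <<A>> = [set: gT].
    have nAG : <<A>>%G <| [set: gT].
      rewrite /normal subsetT norms_gen //.
      exact: nCn.
    have [A_1|//] := simG _ nAG.
    by rewrite [<<A>>]A_1 eqxx in neqA1.
  have [n Dn] := gen_expgs A; exists (#|gT| * n)%N => _ _ m le_m.
  rewrite -(subnKC le_m) addnC expgnDr expgnA -/A.
  have -> : A = 1 |: A by apply/esym/setUidPr; rewrite sub1set.
  rewrite -Dn genA mulT //; apply/set0Pn; exists (x ^+ (m - #|gT| * n)).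
  exact: memC.
have [n nP] := fin_all_exists coverC.
exists (\max_C n C); apply/forall_inP => C Cc; apply/implyP => ntC.
by apply/eqP/(nP C Cc ntC)/leq_bigmax.
Qed.

Definition covering_number (gT : finGroupType)
    (nabG : ~~ abelian [set: gT]) (simG : simple [set: gT]) : nat :=
  ex_minn (class_power_cover_exists nabG simG).

(* Main.v *)
(* A commutator vanishes wherever one of its entries does, so a balanced tree of
   commutators of conjugates of the words h^-1 x, for h <> g0, is trivial off g0;
   balancing keeps its length quadratic in |G|, and since in a non-abelian simple
   group no non-trivial element commutes with all conjugates of another one, the
   conjugating constants can be chosen so that its value at g0 is non-trivial.
   Products of cn(G) conjugates of that word take any prescribed value at g0, and
   a product of such words over all g0 in G induces any map.  Conversely, word
   maps preserve congruence modulo every normal subgroup. *)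

Require Import Defs.
From mathcomp Require Import all_boot all_fingroup all_solvable.
From mathcomp Require Import zify.

Set Implicit Arguments.
Unset Strict Implicit.
Unset Printing Implicit Defensive.

Local Open Scope group_scope.

(** * Length bounds for maps induced by words *)

Section Length.

Variable G : groupType.

Lemma size_lmul_var e (w : raw_word G) : size (lmul_var e w).2 <= (size w.2).+1.
Proof.
by case: w => c [|[e' c'] s] //; rewrite /lmul_var /=; case: ifP => //=; lia.
Qed.

Lemma size_lmul_tail s (w : raw_word G) :
  size (lmul_tail s w).2 <= size s + size w.2.
Proof.
elim: s => //= p s IHs; apply: leq_trans (size_lmul_var _ _) _.
by rewrite addSn ltnS.
Qed.

Lemma size_inv_tail s (w : raw_word G) :
  size (inv_tail s w).2 <= size s + size w.2.
Proof.
elim: s w => //= p s IHs w; apply: leq_trans (IHs _) _.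
by rewrite addSnnS leq_add2l; apply: size_lmul_var.
Qed.

Lemma fp_lengthM (u v : free_prod G) :
  fp_length (u * v) <= fp_length u + fp_length v.
Proof. exact: size_lmul_tail. Qed.

Lemma fp_lengthV (u : free_prod G) : fp_length u^-1 <= fp_length u.
Proof.
by have := size_inv_tail (fp_word u).2 ((fp_word u).1^-1, [::]); rewrite addn0.
Qed.

Lemma word_mapM (u v : free_prod G) g :
  word_map (u * v) g = word_map u g * word_map v g.
Proof. exact: (@fp_liftM G G idfun g). Qed.

Lemma word_mapV (u : free_prod G) g : word_map u^-1 g = (word_map u g)^-1.
Proof.
apply: (mulgI (word_map u g)); rewrite -word_mapM !mulgV.
exact: (@fp_lift1 G G idfun g).
Qed.

Definition induced_within (f : G -> G) (L : nat) :=
  exists w : free_prod G, word_map w =1 f /\ fp_length w <= L.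

Lemma induced_leq f L L' : L <= L' -> induced_within f L -> induced_within f L'.
Proof. by move=> le_L [w [wf /leq_trans wL]]; exists w; split; last exact: wL. Qed.

Lemma induced_cst c : induced_within (fun=> c) 0.
Proof. by exists (fp_cst c); split=> // g; apply: (@fp_lift_cst G G idfun). Qed.

Lemma induced_id : induced_within id 1.
Proof. by exists (fp_var G); split=> // g; apply: (@fp_lift_var G G idfun). Qed.

Lemma inducedM f1 f2 L1 L2 : induced_within f1 L1 -> induced_within f2 L2 ->
  induced_within (fun g => f1 g * f2 g) (L1 + L2).
Proof.
move=> [u [uf uL]] [v [vf vL]]; exists (u * v); split.
  by move=> g; rewrite word_mapM uf vf.
exact: leq_trans (fp_lengthM u v) (leq_add uL vL).
Qed.

Lemma inducedV f L : induced_within f L -> induced_within (fun g => (f g)^-1) L.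
Proof.
move=> [u [uf uL]]; exists u^-1; split; first by move=> g; rewrite word_mapV uf.
exact: leq_trans (fp_lengthV u) uL.
Qed.

Lemma inducedJ f L c : induced_within f L -> induced_within (fun g => f g ^ c) L.
Proof.
move=> /inducedM/(_ (induced_cst c)) fc.
by have := inducedM (induced_cst c^-1) fc; rewrite add0n addn0.
Qed.

Lemma inducedR f1 f2 L : induced_within f1 L -> induced_within f2 L ->
  induced_within (fun g => [~ f1 g, f2 g]) (4 * L).
(* By definition [[~ a, b]] is [a^-1 * (b^-1 * (a * b))], four factors of length at most [L]
   each. *)
Proof.
move=> f1L f2L; apply: (induced_leq _ (inducedM (inducedV f1L)
  (inducedM (inducedV f2L) (inducedM f1L f2L)))); lia.
Qed.

End Length.

(** Rounding the number of leaves of the commutator tree up to a power of two costs at most a factor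
    2. *)
Lemma leq_exp_up_log2 n : 0 < n -> 2 ^ up_log 2 n <= 2 * n.
Proof.
case: n => [|[|n]] // _; have := @up_log_gtn 2 n.+2 isT isT.
have: 0 < up_log 2 n.+2 by rewrite up_log_gt0.
by case: (up_log 2 n.+2) => // k _ /ltnW; rewrite expnS leq_mul2l.
Qed.

(** * Word maps on a non-abelian simple group *)

Section Simple.

Variable gT : finGroupType.
Hypotheses (nabG : ~~ abelian [set: gT]) (simG : simple [set: gT]).
Implicit Types (a b c g h : gT) (s : seq gT).

(** Otherwise the centraliser of the class of [b], a normal subgroup, contains [a != 1] and is the
    whole group. Then [b != 1] is central, so the centre is everything and the group is abelian. *)
Lemma exists_commJ_neq1 a b : a != 1 -> b != 1 -> exists c, [~ a, b ^ c] != 1.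
Proof.
move=> nta ntb; have [_ norG] := simpleP _ simG.
apply/existsP; apply: contraNT nabG; rewrite negb_exists => /forallP cab.
have Ca : a \in 'C(b ^: [set: gT]).
  by apply/centP=> _ /imsetP[c _ ->]; apply/commgP; move: (cab c); rewrite negbK.
have nC : 'C(b ^: [set: gT]) <| [set: gT].
  by rewrite /normal subsetT norms_cent ?class_norm.
have [C1 | CG] := norG _ nC.
  by move: Ca nta; rewrite C1 => /set1P->; rewrite eqxx.
have Zb : b \in 'Z([set: gT]).
  rewrite inE in_setT; apply/centP=> g _; apply/esym.
  by have /centP-> : g \in 'C(b ^: [set: gT]); rewrite ?CG ?inE ?class_refl.
have [Z1 | ZG] := norG _ (center_normal [set: gT]).
  by move: Zb ntb; rewrite Z1 => /set1P->; rewrite eqxx.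
exact/center_idP.
Qed.

(** Each level of the tree halves [s] and multiplies the length by 4, so depth [k] handles [2 ^ k]
    points with length [4 ^ k], the square of their number. *)
Lemma induced_vanishing k g0 s : size s <= 2 ^ k -> g0 \notin s ->
  exists f : gT -> gT,
    [/\ induced_within f (4 ^ k), f g0 != 1 & {in s, forall g, f g = 1}].
Proof.
elim: k s => [|k IHk] s.
  (* Halving can leave an empty list; any non-trivial constant then serves as a leaf. *)
  case: s => [|h [|? ?]] //= _.
    have [a _ nta] : exists2 a : gT, a \in [set: gT] & a != 1.
      by apply/trivgPn; apply: contraNneq nabG => ->; apply: abelian1.
    by exists (fun=> a); split=> //; apply: induced_leq (induced_cst a).
  rewrite inE => nhg; exists (fun g => h^-1 * g); split.
  - exact: inducedM (induced_cst h^-1) (induced_id gT).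
  - by rewrite -eq_mulVg1 eq_sym.
  - by move=> g /[1!inE] /eqP->; rewrite mulVg.
rewrite !expnS => szs; rewrite -(cat_take_drop (2 ^ k) s) mem_cat negb_or.
case/andP=> /IHk[|f1 [f1L f1g f1s]]; first by rewrite size_take_min geq_minl.
case/IHk=> [|f2 [f2L f2g f2s]]; first by rewrite size_drop; lia.
have [c ntc] := exists_commJ_neq1 f1g f2g.
exists (fun g => [~ f1 g, f2 g ^ c]); split=> //.
  exact: inducedR f1L (inducedJ c f2L).
move=> g; rewrite mem_cat => /orP[/f1s | /f2s] ->; first by rewrite comm1g.
by rewrite conj1g commg1.
Qed.

(** Conjugating by a constant adds no letter and keeps the value 1 off [g0], so only the number [m]
    of factors affects the length. *)
Lemma induced_expg_class g0 f L m t :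
    induced_within f L -> (forall g, g != g0 -> f g = 1) ->
    t \in (f g0 ^: [set: gT]) ^+ m ->
  exists f' : gT -> gT,
    [/\ induced_within f' (m * L), f' g0 = t & forall g, g != g0 -> f' g = 1].
Proof.
move=> fL f1; elim: m t => [|m IHm] t.
  by rewrite expg0 => /set1P->; exists (fun=> 1); split=> //; apply: induced_cst.
rewrite expgS => /mulsgP[_ u /imsetP[c _ ->] /IHm[f' [f'L f'g f'1]] ->].
exists (fun g => f g ^ c * f' g); split; last 2 first.
- by rewrite f'g.
- by move=> g ng; rewrite f1 // f'1 // conj1g mulg1.
exact: inducedM (inducedJ c fL) f'L.
Qed.

Lemma induced_at_point g0 t :
  exists f : gT -> gT,
    [/\ induced_within f (covering_number nabG simG * (4 * #|gT| ^ 2)),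
        f g0 = t & forall g, g != g0 -> f g = 1].
Proof.
pose k := up_log 2 #|gT|.
have [||f [fL nt_f f1]] := @induced_vanishing k g0 (enum (predC1 g0)).
- by rewrite -cardE (leq_trans (max_card _)) ?up_logP.
- by rewrite mem_enum !inE eqxx.
rewrite /covering_number; case: ex_minnP => m /forall_inP cov _.
apply: (@induced_expg_class _ f).
(* [4 ^ k] is the square of [2 ^ k <= 2 * #|gT|], whence the constant 4. *)
- apply: induced_leq fL; have gT_gt0 : 0 < #|gT| by apply/card_gt0P; exists 1.
  have := leq_mul (leq_exp_up_log2 gT_gt0) (leq_exp_up_log2 gT_gt0).
  by rewrite -expnMn mulnACA.
- by move=> g ng; apply: f1; rewrite mem_enum !inE.
- have/implyP/(_ _)/eqP-> := cov _ (mem_classes (in_setT (f g0))); rewrite ?inE //.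
  apply: contraNneq nt_f => cl1; rewrite -in_set1 -[[set 1]]cl1 class_refl //.
Qed.

Lemma induced_all f :
  @induced_within gT f (4 * #|gT| ^ 3 * covering_number nabG simG).
Proof.
set L := (covering_number nabG simG * (4 * #|gT| ^ 2))%N.
(* As [s] has no repetitions, at most one factor of the product is non-trivial at any given
   point. *)
have indS s : uniq s -> exists f' : gT -> gT, induced_within f' (size s * L) /\
    forall g, f' g = if g \in s then f g else 1.
  elim: s => [|a s IHs] /=.
    by exists (fun=> 1); split=> //; apply: induced_cst.
  case/andP=> nas /IHs[f' [f'L f'E]].
  have [d [dL da d1]] := induced_at_point a (f a).
  exists (fun g => d g * f' g); split; first exact: inducedM.
  move=> g; rewrite inE f'E.
  have [-> | /d1->] /= := eqVneq g a; last by rewrite mul1g.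
  by rewrite da (negPf nas) mulg1.
have [f' [[w [wf' wL]] f'E]] := indS _ (enum_uniq gT).
exists w; split; first by move=> g; rewrite wf' f'E mem_enum.
by apply: leq_trans wL _; rewrite -cardE /L mulnCA (mulnCA #|gT|) -expnS mulnC.
Qed.

End Simple.

(** * Congruences modulo normal subgroups and the converse *)

Lemma coset_word_map (gT : finGroupType) (H : {group gT}) (w : free_prod gT) g h :
  H <| [set: gT] -> coset H g = coset H h ->
  coset H (word_map w g) = coset H (word_map w h).
Proof.
case/andP=> _ /subsetP nH eq_gh; have {}nH x : x \in 'N(H) by apply: nH.
have eq_cosetM x x' y y' : coset H x = coset H x' -> coset H y = coset H y' ->
    coset H (x * y) = coset H (x' * y').
  by move=> eq_x eq_y; rewrite !morphM //= eq_x eq_y.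
apply: (eq_cosetM) => //; elim: (fp_word w).2 => //= p s IHs.
apply: (eq_cosetM); last exact: eq_cosetM.
by case: p.1 => //; rewrite !morphV //= eq_gh.
Qed.

Lemma simple_of_word_maps (gT : finGroupType) :
    ~~ abelian [set: gT] ->
    (forall f : gT -> gT,
       exists w : free_prod gT, forall g : gT, word_map w g = f g) ->
  simple [set: gT].
Proof.
move=> nabG all_w; apply/simpleP; split.
  by apply: contraNneq nabG => ->; apply: abelian1.
move=> H nHG; have [-> | /trivgPn[h Hh nth]] := eqVneq (H : {set gT}) 1.
  by left.
right; apply/eqP; rewrite eqEsubset subsetT; apply/subsetP=> z _.
(* This map fixes 1 and sends [h] to [z]; since [h] is congruent to 1 modulo [H], so is [z]. *)
have [w wE] := all_w (fun g => if g == 1 then 1 else z).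
have := @coset_word_map _ _ w h 1 nHG; rewrite !wE eqxx (negPf nth) => eq_z.
(* [coset H] takes the default value 1 outside ['N(H)], so [z] must first be placed in the
   normaliser. *)
apply: coset_idr; first by case/andP: nHG => _ /subsetP->; rewrite ?inE.
by rewrite eq_z !coset_id.
Qed.

Theorem theorem2 :
  (forall gT : finGroupType, ~~ abelian [set: gT] ->
     (simple [set: gT] <->
      forall f : gT -> gT,
        exists w : free_prod gT, forall g : gT, word_map w g = f g)) /\
  (exists K : nat, (0 < K)%N /\
     forall (gT : finGroupType) (nabG : ~~ abelian [set: gT])
            (simG : simple [set: gT]) (f : gT -> gT),
       exists w : free_prod gT,
         (forall g : gT, word_map w g = f g) /\
         (fp_length w <= K * #|gT| ^ 3 * covering_number nabG simG)%N).
Proof.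
split=> [gT nabG|]; last by exists 4; split=> // gT nabG simG f; apply: induced_all.
split=> [simG f|]; last exact: simple_of_word_maps.
by have [w [wf _]] := induced_all nabG simG f; exists w.
Qed.
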